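(* Let $d\in\{2,3\}$. There is a constant $C>0$, independent of $n_0$, $L$ (hence of $n_1=n_0L+1$), $\alpha$, $\lambda$ and the realization $\mathcal{K}$, such that the following holds. Let $n_0=2^{p_0}$ with $p_0\ge 2$, let $L\ge 1$ be an integer, let $\alpha$ be such that $2\alpha n_0\in\{2,4,\dots,n_0\}$, let $0<\lambda\le 1$ and $\beta=1-\lambda$, and let $\mathcal{K}\subseteq\{0,\dots,L-1\}^d$ be any set of cells (a realization of the checkerboard coefficient). Let $A=\lambda A_\Delta+\beta\widehat A_s$ be the associated stiffness matrix and let $B_\Delta=\frac{1+\lambda}{2}A_\Delta$. Then, on the subspace $\{\mathbf{u}\in\mathbb{R}^{n_1^d}:\langle \mathbf{u},\mathbf{1}\rangle=0\}$, the preconditioned matrix $B_\Delta^{+}A$ satisfies $$\mathrm{cond}\{B_\Delta^{+}A\}\le C\lambda^{-1}.$$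
   Context: Notation: $n_1=n_0L+1$; $\mathbf{1}\in\mathbb{R}^{n_1^d}$ is the all-ones vector; $\otimes$ is the Kronecker product; $B^{+}$ is the Moore–Penrose pseudo-inverse (so $B_\Delta^+B_\Delta\mathbf{u}=\mathbf{u}$ if $\langle\mathbf{u},\mathbf{1}\rangle=0$, and $B_\Delta^+\mathbf{1}=0$). The condition number of $B_\Delta^+A$ on the subspace $\langle\mathbf{u},\mathbf{1}\rangle=0$ is the ratio of the largest to the smallest eigenvalue of the restriction of $B_\Delta^+A$ to this (invariant) subspace. Periodic Laplacian: $\Delta_P\in\mathbb{R}^{n_1\times n_1}$ is the circulant matrix with first column $(2,-1,0,\dots,0,-1)^T$, and $A_\Delta=\Delta_P\otimes I+I\otimes\Delta_P$ for $d=2$, $A_\Delta=\Delta_P\otimes I\otimes I+I\otimes\Delta_P\otimes I+I\otimes I\otimes\Delta_P$ for $d=3$, with $I$ the $n_1\times n_1$ identity. Stochastic part: put $\overline n_0=2\alpha n_0+1$. Let $\widehat Q\in\mathbb{R}^{\overline n_0\times\overline n_0}$ be the 1D Neumann Laplacian, i.e. the tridiagonal matrix with off-diagonal entries $-1$ and diagonal $(1,2,\dots,2,1)$, and let $\widehat I=\mathrm{diag}\{1/2,1,\dots,1,1/2\}\in\mathbb{R}^{\overline n_0\times\overline n_0}$. For $j\in\{0,\dots,L-1\}$ let $J_j\subset\{1,\dots,n_1\}$ be the set of $\overline n_0$ consecutive indices starting at $jn_0+1+\frac{n_0}{2}-\alpha n_0$ (the sub-cell of grid width $2\alpha n_0$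 centered in the $j$-th cell of $n_0$ grid intervals). Let $\overline Q_j,\overline I_j\in\mathbb{R}^{n_1\times n_1}$ be the zero matrices with the block at $J_j\times J_j$ replaced by $\widehat Q$ and $\widehat I$, respectively. Let $P^{(1)}\in\mathbb{R}^{n_1\times n_1}$ be zero except $P^{(1)}_{1,1}=P^{(1)}_{n_1,n_1}=1$ and $P^{(1)}_{1,n_1}=P^{(1)}_{n_1,1}=-1$, and let $P^{(d)}$ be the $d$-term Kronecker sum of $P^{(1)}$ (e.g. $P^{(2)}=P^{(1)}\otimes I+I\otimes P^{(1)}$). Then for $d=2$ $$\widehat A_s=\sum_{(j_1,j_2)\in\mathcal{K}}\left(\overline Q_{j_1}\otimes\overline I_{j_2}+\overline I_{j_1}\otimes\overline Q_{j_2}\right)+P^{(2)},$$ and for $d=3$ $$\widehat A_s=\sum_{(j_1,j_2,j_3)\in\mathcal{K}}\left(\overline Q_{j_1}\otimes\overline I_{j_2}\otimes\overline I_{j_3}+\overline I_{j_1}\otimes\overline Q_{j_2}\otimes\overline I_{j_3}+\overline I_{j_1}\otimes\overline I_{j_2}\otimes\overline Q_{j_3}\right)+P^{(3)}.$$ The matrix $A=\lambda A_\Delta+\beta\widehat A_s$ is the discretization of $-\nabla\cdot(a\nabla)$ with periodic boundary conditions on $[0,1)^d$, where $a=1$ on the union of the chosen sub-cells and $a=\lambda$ elsewhere. *)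

(* Defs.v *)
From mathcomp Require Import all_boot all_order all_algebra.
From mathcomp Require Import classical_sets reals.
From mathcomp Require Export mxtens.

Set Implicit Arguments.
Unset Strict Implicit.
Unset Printing Implicit Defensive.

Import Order.TTheory GRing.Theory Num.Theory.
Local Open Scope ring_scope.

(** * Kronecker products with [d] factors *)

Section Kronecker.
Variable R : pzRingType.

(* The base case is a single factor, as in [ntensmx]: this way [n ^ d] is the
   dimension up to conversion and no cast is needed. *)
Fixpoint kron_rec n k : ('I_k.+1 -> 'M[R]_n) -> 'M[R]_(n ^ k.+1) :=
  if k is k'.+1 return ('I_k.+1 -> 'M[R]_n) -> 'M[R]_(n ^ k.+1) then
    fun M => M ord0 *t kron_rec (fun i => M (lift ord0 i))
  else fun M => M ord0.

Definition kron n d : ('I_d -> 'M[R]_n) -> 'M[R]_(n ^ d) :=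
  if d is k.+1 return ('I_d -> 'M[R]_n) -> 'M[R]_(n ^ d) then
    @kron_rec n k
  else fun=> 1%:M.

Definition kron_sum n d (X : 'M[R]_n) : 'M[R]_(n ^ d) :=
  \sum_(i < d) kron (fun k => if k == i then X else 1%:M).

Lemma kron_sum2 n (X : 'M[R]_n) :
  kron_sum 2 X = X *t 1%:M + 1%:M *t X.
Proof. by rewrite /kron_sum !big_ord_recl big_ord0 addr0. Qed.

Lemma kron_sum3 n (X : 'M[R]_n) :
  kron_sum 3 X = X *t (1%:M *t 1%:M) + 1%:M *t (X *t 1%:M)
                 + 1%:M *t (1%:M *t X).
Proof. by rewrite /kron_sum !big_ord_recl big_ord0 addr0 addrA. Qed.

End Kronecker.

(** * Moore-Penrose pseudo-inverse *)

Section PseudoInverse.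
Variable R : realType.

Definition moore_penrose m n (B : 'M[R]_(m, n)) (X : 'M[R]_(n, m)) : Prop :=
  [/\ B *m X *m B = B, X *m B *m X = X,
      (B *m X)^T = B *m X & (X *m B)^T = X *m B].

Definition mp_pinv m n (B : 'M[R]_(m, n)) : 'M[R]_(n, m) :=
  xget 0 [set X | moore_penrose B X]%classic.

Lemma gram_unitmx m n (F : 'M[R]_(m, n)) :
  row_free F -> F *m F^T \in unitmx.
Proof.
move=> Ffree; rewrite -row_free_unit -kermx_eq0; apply/eqP/row_matrixP => i.
rewrite row0; set v := row i _.
have vFF : v *m (F *m F^T) = 0 by apply/sub_kermxP; rewrite row_sub.
have vF0 : v *m F = 0.
  have : (v *m F) *m (v *m F)^T = 0.
    by rewrite trmx_mul mulmxA -(mulmxA v) vFF mul0mx.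
  move: (v *m F) => w /matrixP /(_ 0 0); rewrite !mxE => /eqP.
  rewrite psumr_eq0 => [/allP ww|k _]; last by rewrite mxE -expr2 sqr_ge0.
  apply/rowP => k; rewrite mxE.
  by have := ww k (mem_index_enum _); rewrite mxE -expr2 sqrf_eq0 => /eqP.
by apply: (row_free_inj Ffree); rewrite vF0 mul0mx.
Qed.

Lemma moore_penrose_factor m r n (C : 'M[R]_(m, r)) (F : 'M[R]_(r, n)) :
  row_full C -> row_free F -> exists X, moore_penrose (C *m F) X.
Proof.
move=> Cfull Ffree.
have FU : F *m F^T \in unitmx by exact: gram_unitmx.
have CU : C^T *m C \in unitmx.
  by have := @gram_unitmx _ _ C^T; rewrite trmxK /row_free mxrank_tr; apply.
set G := invmx (F *m F^T); set H := invmx (C^T *m C).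
have GT : G^T = G by rewrite /G trmx_inv trmx_mul trmxK.
have HT : H^T = H by rewrite /H trmx_inv trmx_mul trmxK.
exists (F^T *m G *m H *m C^T).
have BX : C *m F *m (F^T *m G *m H *m C^T) = C *m H *m C^T.
  by rewrite !mulmxA -(mulmxA C F) -(mulmxA C _ G) mulmxV // mulmx1.
have XB : F^T *m G *m H *m C^T *m (C *m F) = F^T *m G *m F.
  by rewrite !mulmxA -(mulmxA _ C^T C) -(mulmxA _ H) mulVmx // mulmx1.
split.
- by rewrite BX !mulmxA -(mulmxA _ C^T C) -(mulmxA _ H) mulVmx // mulmx1.
- rewrite XB !mulmxA -(mulmxA _ F F^T) -(mulmxA _ G (F *m _)) mulVmx //.
  by rewrite mulmx1.
- by rewrite BX !trmx_mul trmxK HT mulmxA.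
- by rewrite XB !trmx_mul trmxK GT mulmxA.
Qed.

Lemma mp_pinvP m n (B : 'M[R]_(m, n)) : moore_penrose B (mp_pinv B).
Proof.
apply: xgetPex.
have := moore_penrose_factor (col_base_full B) (row_base_free B).
by rewrite mulmx_base.
Qed.

Lemma moore_penrose_unique m n (B : 'M[R]_(m, n)) (X Y : 'M[R]_(n, m)) :
  moore_penrose B X -> moore_penrose B Y -> X = Y.
Proof.
move=> [BXB XBX BXT XBT] [BYB YBY BYT YBT].
have BXY : B *m X = B *m Y.
  by rewrite -[LHS]BXT -{1}BYB -mulmxA trmx_mul BXT BYT mulmxA BXB.
have XYB : X *m B = Y *m B.
  by rewrite -[LHS]XBT -{1}BYB -(mulmxA B) mulmxA trmx_mul XBT YBT
             -mulmxA (mulmxA B) BXB.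
by rewrite -XBX XYB -mulmxA BXY mulmxA YBY.
Qed.

End PseudoInverse.

(** * Condition number on a subspace *)

Section Condition.
Variables (R : realType) (N : nat).

Definition dotv (u v : 'cV[R]_N) : R := \sum_i u i 0 * v i 0.

Definition ones_orth : set 'cV[R]_N :=
  [set u | dotv u (const_mx 1) = 0]%classic.

(* For an [M]-invariant subspace [V], these are the eigenvalues of the
   restriction of the operator [u |-> M *m u] to [V]. *)
Definition spectrum_on (V : set 'cV[R]_N) (M : 'M[R]_N) : set R :=
  [set a | exists u, [/\ V u, u != 0 & M *m u = a *: u]]%classic.

Definition is_cond_on (V : set 'cV[R]_N) (M : 'M[R]_N) (c : R) : Prop :=
  exists lmax lmin : R,
    [/\ spectrum_on V M lmax /\ (forall a, spectrum_on V M a -> a <= lmax),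
        spectrum_on V M lmin /\ (forall a, spectrum_on V M a -> lmin <= a),
        0 < lmin
      & c = lmax / lmin].

End Condition.

(** * The matrices

   Indices are shifted to start at 0.  In all that follows [w] stands for the
   integer [2 * alpha * n0]: [w.+1] is the number of grid points of a
   sub-cell in each direction. *)

Section Matrices.
Variable R : realType.

Definition circulant n (c : 'cV[R]_n.+1) : 'M[R]_n.+1 :=
  \matrix_(i, j) c (i - j) 0. (* subtraction modulo [n.+1] in ['I_n.+1] *)

Definition lap_per n : 'M[R]_n.+1 :=
  circulant (\col_(i < n.+1)
    if i == 0%N :> nat then 2
    else if (i == 1%N :> nat) || (i == n :> nat) then -1 else 0).

Definition lap_neumann w : 'M[R]_w.+1 :=
  \matrix_(i < w.+1, j < w.+1)
    if i == j then (if (i == 0%N :> nat) || (i == w :> nat) then 1 else 2)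
    else if (i.+1 == j) || (j.+1 == i) then -1 else 0.

Definition half_id w : 'M[R]_w.+1 :=
  diag_mx (\row_(i < w.+1)
    if (i == 0%N :> nat) || (i == w :> nat) then 2^-1 else 1).

Definition embed_block n w (s : nat) (X : 'M[R]_w.+1) : 'M[R]_n :=
  \matrix_(i < n, j < n)
    if (s <= i <= s + w)%N && (s <= j <= s + w)%N
    then X (inord (i - s)) (inord (j - s)) else 0.

Definition corner n : 'M[R]_n.+1 :=
  \matrix_(i < n.+1, j < n.+1)
    if ((i == 0%N :> nat) || (i == n :> nat))
       && ((j == 0%N :> nat) || (j == n :> nat))
    then (if i == j then 1 else -1) else 0.

Section Cells.
Variables (d n0 L w : nat).

Local Notation n1 := (n0 * L).+1.

Definition cell_start (j : 'I_L) : nat := (j * n0 + n0./2 - w./2)%N.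

Definition Qbar (j : 'I_L) : 'M[R]_n1 :=
  embed_block n1 (cell_start j) (lap_neumann w).

Definition Ibar (j : 'I_L) : 'M[R]_n1 :=
  embed_block n1 (cell_start j) (half_id w).

Definition A_lap : 'M[R]_(n1 ^ d) := kron_sum d (lap_per (n0 * L)).

Definition A_stoch (K : {set d.-tuple 'I_L}) : 'M[R]_(n1 ^ d) :=
  \sum_(j in K) \sum_(i < d)
     kron (fun k => if k == i then Qbar (tnth j k) else Ibar (tnth j k))
  + kron_sum d (corner (n0 * L)).

Definition A_stiff (lambda : R) (K : {set d.-tuple 'I_L}) : 'M[R]_(n1 ^ d) :=
  lambda *: A_lap + (1 - lambda) *: A_stoch K.

Definition B_lap (lambda : R) : 'M[R]_(n1 ^ d) :=
  ((1 + lambda) / 2) *: A_lap.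

End Cells.

Lemma A_stoch2 n0 L w (K : {set 2.-tuple 'I_L}) :
  A_stoch n0 w K =
    \sum_(j in K) (Qbar n0 w (tnth j 0) *t Ibar n0 w (tnth j 1)
                   + Ibar n0 w (tnth j 0) *t Qbar n0 w (tnth j 1))
    + kron_sum 2 (corner (n0 * L)).
Proof.
congr (_ + _); apply: eq_bigr => j _.
rewrite !big_ord_recl big_ord0 addr0 /=.
by have -> : lift ord0 ord0 = 1 :> 'I_2 by exact: val_inj.
Qed.

Lemma A_stoch3 n0 L w (K : {set 3.-tuple 'I_L}) :
  let Q (j : 3.-tuple 'I_L) k := Qbar n0 w (tnth j k) in
  let I (j : 3.-tuple 'I_L) k := Ibar n0 w (tnth j k) in
  A_stoch n0 w K =
    \sum_(j in K) (Q j 0 *t (I j 1 *t I j 2%:R)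
                   + I j 0 *t (Q j 1 *t I j 2%:R)
                   + I j 0 *t (I j 1 *t Q j 2%:R))
    + kron_sum 3 (corner (n0 * L)).
Proof.
move=> Q I; congr (_ + _); apply: eq_bigr => j _.
rewrite !big_ord_recl big_ord0 addr0 addrA /=.
have -> : lift ord0 (lift ord0 ord0) = 2%:R :> 'I_3 by exact: val_inj.
by have -> : lift ord0 ord0 = 1 :> 'I_3 by exact: val_inj.
Qed.

End Matrices.

Arguments A_stiff {R d} n0 {L} w lambda K.
Arguments B_lap {R} d n0 L lambda.

(* Main.v *)
(* The bound holds with [C = 1].  In the Loewner order [0 <= A_stoch <= A_lap].
   Indeed, adding the missing cells to [K] only increases [A_stoch], and the sum
   over all cells factorises into Kronecker products of [\sum_j Qbar j] and
   [\sum_j Ibar j].  The Neumann Laplacian and the lumped mass matrix of an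
   interval are the sums of those of the tiles of a subdivision, and the
   sub-cells lie in distinct tiles, so these two sums are bounded by the Neumann
   Laplacian of the whole grid and by the identity; the periodic Laplacian is
   the Neumann one plus the corner matrix.  Hence [lambda A_lap <= A <= A_lap].
   As [A_lap] is positive definite on the complement of its kernel (the
   constants), an eigenpair [B^+ A u = a u] there gives
   [<A u, u> = a <B u, u>], so that [lambda / t <= a <= 1 / t] with
   [t = (1 + lambda) / 2]. *)
Require Import Defs.
From mathcomp Require Import all_boot all_order all_algebra.
From mathcomp Require Import classical_sets cardinality reals.
From mathcomp Require Import complex polyrcf ring lra zify.

Set Implicit Arguments.
Unset Strict Implicit.
Unset Printing Implicit Defensive.

Import Order.TTheory GRing.Theory Num.Theory.
Local Open Scope ring_scope.

(** * The Loewner order *)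

(* In Gram form, stability under Kronecker products is immediate. *)
Definition psd (R : rcfType) n (X : 'M[R]_n) : Prop :=
  exists m (F : 'M[R]_(m, n)), X = F^T *m F.

Definition loewner (R : rcfType) n (X Y : 'M[R]_n) : Prop := psd (Y - X).

Notation "X <=L Y" := (loewner X Y) (at level 70, Y at next level).

Section Loewner.
Variable R : rcfType.

Definition qform n (X : 'M[R]_n) (u : 'cV[R]_n) : R := (u^T *m X *m u) 0 0.

Lemma qformD n (X Y : 'M[R]_n) u : qform (X + Y) u = qform X u + qform Y u.
Proof. by rewrite /qform mulmxDr mulmxDl !mxE. Qed.

Lemma qformB n (X Y : 'M[R]_n) u : qform (X - Y) u = qform X u - qform Y u.
Proof. by rewrite /qform mulmxBr mulmxBl !mxE. Qed.

Lemma qformZ n a (X : 'M[R]_n) u : qform (a *: X) u = a * qform X u.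
Proof. by rewrite /qform -scalemxAr -scalemxAl mxE. Qed.

Lemma qform_gram m n (F : 'M[R]_(m, n)) u :
  qform (F^T *m F) u = \sum_i (F *m u) i 0 ^+ 2.
Proof.
rewrite /qform mulmxA -trmx_mul -mulmxA mxE.
by apply: eq_bigr => i _; rewrite [_^T _ _]mxE expr2.
Qed.

Lemma qform_gram_eq0 m n (F : 'M[R]_(m, n)) u :
  qform (F^T *m F) u = 0 -> F *m u = 0.
Proof.
rewrite qform_gram => /psumr_eq0P Fu0; apply/colP => i; rewrite [RHS]mxE.
by apply/eqP; rewrite -sqrf_eq0 Fu0 // => j _; exact: sqr_ge0.
Qed.

Lemma gram_mulmx_eq0 m n (F : 'M[R]_(m, n)) (u : 'cV_n) :
  F^T *m F *m u = 0 <-> F *m u = 0.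
Proof.
split=> [FFu0|Fu0]; last by rewrite -mulmxA Fu0 mulmx0.
by apply: qform_gram_eq0; rewrite /qform -mulmxA FFu0 mulmx0 mxE.
Qed.

Lemma psd_qform_ge0 n (X : 'M[R]_n) u : psd X -> 0 <= qform X u.
Proof.
by case=> m [F ->]; rewrite qform_gram; apply: sumr_ge0 => i _; exact: sqr_ge0.
Qed.

Lemma psd_qform_eq0 n (X : 'M[R]_n) u : psd X -> qform X u = 0 -> X *m u = 0.
Proof. by case=> m [F ->] /qform_gram_eq0 Fu0; apply/gram_mulmx_eq0. Qed.

Lemma psd_sym n (X : 'M[R]_n) : psd X -> X^T = X.
Proof. by case=> m [F ->]; rewrite trmx_mul trmxK. Qed.

Lemma psd_gram m n (F : 'M[R]_(m, n)) : psd (F^T *m F).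
Proof. by exists m, F. Qed.

Lemma psd0 n : psd (0 : 'M[R]_n).
Proof. by exists n, 0; rewrite mulmx0. Qed.

Lemma psd1 n : psd (1%:M : 'M[R]_n).
Proof. by exists n, 1%:M; rewrite trmx1 mulmx1. Qed.

Lemma psdD n (X Y : 'M[R]_n) : psd X -> psd Y -> psd (X + Y).
Proof.
case=> m [F ->] [p [G ->]]; exists (m + p)%N, (col_mx F G).
by rewrite tr_col_mx mul_row_col.
Qed.

Lemma psd_sum n (I : Type) (r : seq I) (P : pred I) (X : I -> 'M[R]_n) :
  (forall i, P i -> psd (X i)) -> psd (\sum_(i <- r | P i) X i).
Proof.
by move=> psdX; elim/big_ind: _ => //; [exact: psd0 | exact: psdD].
Qed.

Lemma psd_congr m n (E : 'M[R]_(m, n)) X : psd X -> psd (E^T *m X *m E).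
Proof.
by case=> p [F ->]; rewrite mulmxA -mulmxA -trmx_mul; exact: psd_gram.
Qed.

Lemma psd_diag n (v : 'rV[R]_n) : (forall i, 0 <= v 0 i) -> psd (diag_mx v).
Proof.
move=> v_ge0; exists n, (diag_mx (\row_i Num.sqrt (v 0 i))).
rewrite tr_diag_mx mulmx_diag; congr diag_mx; apply/rowP => i.
by rewrite !mxE -expr2 sqr_sqrtr.
Qed.

Lemma psdZ n a (X : 'M[R]_n) : 0 <= a -> psd X -> psd (a *: X).
Proof.
move=> a_ge0 [m [F ->]]; exists m, (Num.sqrt a *: F).
by rewrite [(_ *: F)^T]linearZ -scalemxAl -scalemxAr scalerA -expr2 sqr_sqrtr.
Qed.

Lemma psdD_mulmx_eq0 n (X Y : 'M[R]_n) (u : 'cV_n) : psd X -> psd Y ->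
  (X + Y) *m u = 0 <-> X *m u = 0 /\ Y *m u = 0.
Proof.
move=> psdX psdY; split=> [XYu0|[Xu0 Yu0]]; last first.
  by rewrite mulmxDl Xu0 Yu0 addr0.
have : qform (X + Y) u = 0 by rewrite /qform -mulmxA XYu0 mulmx0 mxE.
rewrite qformD => /eqP; rewrite paddr_eq0 ?psd_qform_ge0 // => /andP[qX qY].
by split; apply: psd_qform_eq0 => //; apply/eqP.
Qed.

Lemma loewner_refl n (X : 'M[R]_n) : X <=L X.
Proof. by rewrite /loewner subrr; exact: psd0. Qed.

Lemma loewner_trans n (Y X Z : 'M[R]_n) : X <=L Y -> Y <=L Z -> X <=L Z.
Proof. by move=> XY YZ; rewrite /loewner -(subrK Y Z) -addrA; apply: psdD. Qed.

Lemma loewner_anti n (X Y : 'M[R]_n) : X <=L Y -> Y <=L X -> X = Y.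
Proof.
move=> XY YX; apply/matrixP => i j; pose e : 'cV[R]_n := delta_mx j 0.
apply/esym/eqP; rewrite -subr_eq0; apply/eqP.
suff : (Y - X) *m e = 0 by rewrite -colE => /colP/(_ i); rewrite !mxE.
apply: psd_qform_eq0 => //; apply/eqP; rewrite eq_le psd_qform_ge0 // andbT.
by rewrite -oppr_ge0 qformB opprB -qformB psd_qform_ge0.
Qed.

Lemma loewner_ge0 n (X Y : 'M[R]_n) : psd X -> X <=L Y -> psd Y.
Proof. by move=> psdX XY; rewrite -(subrK X Y); apply: psdD. Qed.

Lemma loewnerD n (X X' Y Y' : 'M[R]_n) :
  X <=L X' -> Y <=L Y' -> X + Y <=L X' + Y'.
Proof. by rewrite /loewner opprD addrACA; exact: psdD. Qed.

Lemma loewner_addr n (X Y : 'M[R]_n) : psd Y -> X <=L X + Y.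
Proof. by rewrite /loewner addrAC subrr add0r. Qed.

Lemma loewner_sum n (I : Type) (r : seq I) (P : pred I) (X Y : I -> 'M[R]_n) :
  (forall i, P i -> X i <=L Y i) ->
  \sum_(i <- r | P i) X i <=L \sum_(i <- r | P i) Y i.
Proof. by rewrite /loewner -sumrB; exact: psd_sum. Qed.

Lemma loewner_sum_cond n (I : finType) (P : pred I) (X : I -> 'M[R]_n) :
  (forall i, psd (X i)) -> \sum_(i | P i) X i <=L \sum_i X i.
Proof.
move=> psdX; rewrite [X in _ <=L X](bigID P) /=; apply: loewner_addr.
exact: psd_sum.
Qed.

Lemma loewner_congr m n (E : 'M[R]_(m, n)) X Y :
  X <=L Y -> E^T *m X *m E <=L E^T *m Y *m E.
Proof. by rewrite /loewner -mulmxBl -mulmxBr; exact: psd_congr. Qed.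

Lemma loewner_qform n (X Y : 'M[R]_n) u : X <=L Y -> qform X u <= qform Y u.
Proof. by move=> XY; rewrite -subr_ge0 -qformB psd_qform_ge0. Qed.

End Loewner.

Lemma finite_set_has_max disp (T : orderType disp) (S : set T) :
  finite_set S -> (S !=set0)%classic ->
  exists2 x, S x & forall y, S y -> (y <= x)%O.
Proof.
move=> /finite_seqP[s ->] [x0 sx0].
case: (@arg_maxP _ _ (seq_sub s) (SeqSub sx0) xpredT val) => // x _ x_max.
by exists (val x) => [|y sy]; [exact: valP | exact: (x_max (SeqSub sy))].
Qed.

Lemma finite_set_has_min disp (T : orderType disp) (S : set T) :
  finite_set S -> (S !=set0)%classic ->
  exists2 x, S x & forall y, S y -> (x <= y)%O.
Proof. exact: (@finite_set_has_max _ T^d). Qed.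

Section ExtremeEigenvalues.
Variables (R : realType) (n : nat).

Lemma spectrum_on_finite (V : set 'cV[R]_n) (M : 'M[R]_n) :
  finite_set (spectrum_on V M).
Proof.
apply: (@sub_finite_set _ _ [set` rootsR (char_poly M^T)]%classic); last first.
  exact: finite_seq.
move=> a [u [_ u_neq0 Mu]] /=.
rewrite -(roots_on_rootsR (monic_neq0 (char_poly_monic _))) /=.
rewrite -eigenvalue_root_char; apply/eigenvalueP; exists u^T.
  by rewrite -trmx_mul Mu linearZ.
by rewrite trmx_eq0.
Qed.

Lemma is_cond_on_bound (V : set 'cV[R]_n) (M : 'M[R]_n) (l m : R) : 0 < l ->
  (spectrum_on V M !=set0)%classic ->
  (forall a, spectrum_on V M a -> l <= a <= m) ->
  exists2 c, is_cond_on V M c & c <= m / l.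
Proof.
move=> l_gt0 neS bS; have finS := spectrum_on_finite V M.
have [lmax Smax max_lmax] := finite_set_has_max finS neS.
have [lmin Smin min_lmin] := finite_set_has_min finS neS.
have [/andP[_ lmax_le] /andP[le_lmin _]] := (bS _ Smax, bS _ Smin).
have lmin_gt0 := lt_le_trans l_gt0 le_lmin.
exists (lmax / lmin); first by exists lmax, lmin.
apply: ler_pM => //; last by rewrite lef_pV2.
  exact/ltW/(lt_le_trans lmin_gt0)/max_lmax.
by rewrite invr_ge0 ltW.
Qed.

End ExtremeEigenvalues.

Lemma sym_neq0_eigenvalue (R : rcfType) n (X : 'M[R]_n) :
  X^T = X -> X != 0 -> exists2 a, a != 0 & eigenvalue X a.
Proof.
move=> symX; pose Z := map_mx (real_complex R) X.
rewrite -(map_mx_eq0 (real_complex R)) -/Z => Z_neq0.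
have hermZ : Z \is hermsymmx.
  apply: realsym_hermsym.
    by apply/is_hermitianmxP; rewrite expr0 scale1r map_mx_id // map_trmx symX.
  by apply/mxOverP => i j; rewrite mxE; apply/complex_realP; exists (X i j).
have ZE := orthomx_spectralP (hermitian_normalmx hermZ).
have [i d_neq0] : exists i, spectral_diag Z 0 i != 0.
  apply/existsP; apply: contraNT Z_neq0 => /existsPn d_eq0.
  suff -> : Z = 0 by [].
  rewrite ZE (_ : spectral_diag Z = 0) ?linear0 ?mulmx0 ?mul0mx //.
  by apply/rowP => i; rewrite mxE; apply/eqP/negPn/d_eq0.
have /mxOverP/(_ 0 i)/complex_realP[a daE] :=
  hermitian_spectral_diag_real hermZ.
exists a; first by apply: contraNneq d_neq0 => a0; rewrite daE a0.
rewrite -(eigenvalue_map (real_complex R)) -/Z.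
apply/eigenvalueP; exists (row i (spectralmx Z)).
  rewrite -row_mul [X in _ *m X]ZE !mulmxA mulmxV ?spectral_unit // mul1mx.
  by rewrite row_mul row_diag_mx -scalemxAl -rowE daE.
rewrite rowE mulmx_free_eq0 ?row_free_unit ?spectral_unit //.
by apply/eqP => /rowP/(_ i)/eqP; rewrite !mxE !eqxx oner_eq0.
Qed.

(** * Preconditioning by a pseudo-inverse *)

Section PseudoInverse.
Variable R : realType.

Lemma moore_penrose_trmx m n (B : 'M[R]_(m, n)) X :
  moore_penrose B X -> moore_penrose B^T X^T.
Proof.
case=> BXB XBX BXT XBT; split; rewrite -!trmx_mul ?mulmxA ?BXB ?XBX //.
  by rewrite XBT.
by rewrite BXT.
Qed.

Lemma mp_pinv_sym n (B : 'M[R]_n) : B^T = B -> (mp_pinv B)^T = mp_pinv B.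
Proof.
move=> symB; apply: moore_penrose_unique (mp_pinvP B).
by rewrite -{1}symB; exact/moore_penrose_trmx/mp_pinvP.
Qed.

Lemma psd_mp_pinv n (B : 'M[R]_n) : psd B -> psd (mp_pinv B).
Proof.
move=> psdB; have [_ PBP _ _] := mp_pinvP B.
by rewrite -PBP -{1}(mp_pinv_sym (psd_sym psdB)); exact: psd_congr.
Qed.

Definition pinv_range n (B : 'M[R]_n) : set 'cV[R]_n :=
  [set u | mp_pinv B *m B *m u = u]%classic.

End PseudoInverse.

Section Preconditioner.
Variables (R : realType) (n : nat) (A B : 'M[R]_n) (l m : R).
Hypotheses (psdB : psd B) (l_gt0 : 0 < l).
Hypotheses (A_ge : l *: B <=L A) (A_le : A <=L m *: B).

Let P := mp_pinv B.

Lemma qform_pinv_range_gt0 u : pinv_range B u -> u != 0 -> 0 < qform B u.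
Proof.
move=> Vu; rewrite lt_def psd_qform_ge0 // andbT; apply: contraNneq.
by move=> /(psd_qform_eq0 psdB) Bu0; rewrite -Vu -mulmxA Bu0 mulmx0.
Qed.

Lemma qform_precond u a : pinv_range B u -> P *m A *m u = a *: u ->
  qform A u = a * qform B u.
Proof.
move=> Vu PAu; have symP : P^T = P by exact/mp_pinv_sym/psd_sym.
rewrite /qform -{1}Vu !trmx_mul (psd_sym psdB) symP.
by rewrite -!mulmxA (mulmxA P) PAu -!scalemxAr mxE.
Qed.

Lemma spectrum_precond_bounds a :
  spectrum_on (pinv_range B) (P *m A) a -> l <= a <= m.
Proof.
case=> u [Vu u_neq0 PAu]; have q_gt0 := qform_pinv_range_gt0 Vu u_neq0.
have := loewner_qform u A_ge; have := loewner_qform u A_le.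
by rewrite !qformZ (qform_precond Vu PAu) !ler_pM2r // => -> ->.
Qed.

Lemma precond_congr_neq0 p (E : 'M[R]_(n, p)) :
  P = E *m E^T -> B != 0 -> E^T *m A *m E != 0.
Proof.
move=> PE; apply: contra_neq => EAE0.
have [BPB PBP _ _] := mp_pinvP B; rewrite -/P in BPB PBP.
have lEBE0 : l *: (E^T *m B *m E) = 0.
  apply: loewner_anti; last first.
    by rewrite /loewner subr0; apply/psdZ/psd_congr => //; exact: ltW.
  by rewrite -EAE0 scalemxAl scalemxAr; exact: loewner_congr.
have EBE0 : E^T *m B *m E = 0.
  by apply/eqP; move/eqP: lEBE0; rewrite scaler_eq0 gt_eqF.
have P0 : P = 0.
  have -> : P = E *m (E^T *m B *m E) *m E^T by rewrite -PBP PE !mulmxA.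
  by rewrite EBE0 mulmx0 mul0mx.
by rewrite -BPB P0 mulmx0 mul0mx.
Qed.

(* Writing [P = E E^T], the nonzero eigenvalues of [P A = E (E^T A)] are those
   of the symmetric matrix [E^T A E]. *)
Lemma spectrum_precond_nonempty :
  B != 0 -> (spectrum_on (pinv_range B) (P *m A) !=set0)%classic.
Proof.
move=> B_neq0; have [_ PBP _ _] := mp_pinvP B.
have [p [F PF]] := psd_mp_pinv psdB.
pose E := F^T; have PE : P = E *m E^T by rewrite trmxK.
have psdA : psd A by apply: loewner_ge0 A_ge; apply: psdZ => //; exact: ltW.
have symEAE := psd_sym (psd_congr E psdA).
have [a a_neq0 /eigenvalueP[x xEAE x_neq0]] :=
  sym_neq0_eigenvalue symEAE (precond_congr_neq0 PE B_neq0).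
pose u := E *m x^T.
have EAu : E^T *m A *m u = a *: x^T.
  by rewrite mulmxA -symEAE -trmx_mul xEAE linearZ.
have PAu : P *m A *m u = a *: u.
  by rewrite PE -!mulmxA (mulmxA E^T) EAu -scalemxAr.
exists a, u; split=> //.
  by apply: (scalerI a_neq0); rewrite scalemxAr -PAu !mulmxA PBP.
apply: contraTneq x_neq0 => u0; move/eqP: EAu.
by rewrite u0 mulmx0 eq_sym scaler_eq0 (negPf a_neq0) trmx_eq0 negbK.
Qed.

Lemma precond_is_cond_on : B != 0 ->
  exists2 c, is_cond_on (pinv_range B) (P *m A) c & c <= m / l.
Proof.
move=> B_neq0; apply: is_cond_on_bound => //.
  exact: spectrum_precond_nonempty.
exact: spectrum_precond_bounds.
Qed.

End Preconditioner.

Section ConstantKernel.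
Variable R : fieldType.

Definition constant_cV n (u : 'cV[R]_n) : Prop := forall i j, u i 0 = u j 0.

Definition ker_constant n (X : 'M[R]_n) : Prop :=
  forall u : 'cV[R]_n, X *m u = 0 <-> constant_cV u.

Lemma ker_constant_mx n p (X : 'M[R]_n) (U : 'M_(n, p)) : ker_constant X ->
  X *m U = 0 <-> forall i i' j, U i j = U i' j.
Proof.
move=> kerX; split=> [XU0 i i' j|U_const].
  have /kerX/(_ i i') : X *m col j U = 0 by rewrite colE mulmxA XU0 mul0mx.
  by rewrite !mxE.
apply/matrixP => i j; have /kerX : constant_cV (col j U).
  by move=> a b; rewrite !mxE.
by rewrite colE mulmxA -colE => /colP/(_ i); rewrite !mxE.
Qed.

Lemma ker_constantZ n a (X : 'M[R]_n) :
  a != 0 -> ker_constant X -> ker_constant (a *: X).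
Proof.
move=> a_neq0 kerX u; rewrite -kerX -scalemxAl.
split=> [/eqP|->]; last by rewrite scaler0.
by rewrite scaler_eq0 (negPf a_neq0) => /eqP.
Qed.

Lemma ker_constant_neq0 n (X : 'M[R]_n) : (1 < n)%N -> ker_constant X -> X != 0.
Proof.
case: n X => [|[|n]] // X _ kerX; apply/eqP => X0.
have /kerX/(_ ord0 ord_max)/eqP : X *m delta_mx ord0 0 = 0 :> 'cV_n.+2.
  by rewrite X0 mul0mx.
by rewrite !mxE eqxx oner_eq0.
Qed.

End ConstantKernel.

Section OnesOrth.
Variable R : realType.

Lemma constant_ones_orth_eq0 n (u : 'cV[R]_n) :
  constant_cV u -> ones_orth u -> u = 0.
Proof.
move=> u_const; rewrite /ones_orth /= /dotv => sum_u; apply/colP => i.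
rewrite [RHS]mxE; move: sum_u.
under eq_bigr => j _ do rewrite (u_const j i) mxE mulr1.
rewrite sumr_const card_ord => /eqP; rewrite mulrn_eq0 => /orP[/eqP n0|/eqP //].
by have := ltn_ord i; rewrite {2}n0.
Qed.

Lemma ones_orthE n (u : 'cV[R]_n) :
  ones_orth u <-> u^T *m (const_mx 1 : 'cV_n) = 0.
Proof.
have dotE : dotv u (const_mx 1) = (u^T *m (const_mx 1 : 'cV_n)) 0 0.
  by rewrite mxE; apply: eq_bigr => i _; rewrite [u^T _ _]mxE.
rewrite /ones_orth /= dotE; split=> [u1|->]; last by rewrite mxE.
by apply/matrixP => i j; rewrite !ord1 u1 mxE.
Qed.

Lemma ones_orthB n (u v : 'cV[R]_n) :
  ones_orth u -> ones_orth v -> ones_orth (u - v).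
Proof.
rewrite !ones_orthE => u1 v1.
by rewrite [(u - v)^T]linearB mulmxBl u1 v1 subr0.
Qed.

Lemma ones_orth_pinv_range n (B : 'M[R]_n) :
  B^T = B -> ker_constant B -> @ones_orth R n = pinv_range B.
Proof.
move=> symB kerB; have [BPB _ _ PBT] := mp_pinvP B.
have B1 : B *m const_mx 1 = 0 :> 'cV_n by apply/kerB => i j; rewrite !mxE.
have PB_orth (u : 'cV_n) : ones_orth (mp_pinv B *m B *m u).
  by apply/ones_orthE; rewrite trmx_mul PBT -!mulmxA B1 !mulmx0.
apply/seteqP; split=> [u u_orth|u <- //].
apply/eqP; rewrite -subr_eq0; apply/eqP/constant_ones_orth_eq0.
  by apply/kerB; rewrite mulmxBr !mulmxA BPB subrr.
exact: ones_orthB.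
Qed.

Lemma precond_ones_orth_cond n (A B : 'M[R]_n) (l m : R) : (1 < n)%N ->
  psd B -> ker_constant B -> 0 < l -> l *: B <=L A -> A <=L m *: B ->
  exists2 c, is_cond_on (@ones_orth R n) (mp_pinv B *m A) c & c <= m / l.
Proof.
move=> n_gt1 psdB kerB l_gt0 A_ge A_le.
rewrite (ones_orth_pinv_range (psd_sym psdB) kerB).
by apply: precond_is_cond_on => //; exact: ker_constant_neq0 kerB.
Qed.

End OnesOrth.

(** * Kronecker products *)

Section Kronecker.
Variable R : comNzRingType.

Lemma kron_entry n d : exists coords : 'I_(n ^ d) -> 'I_d -> 'I_n,
  forall (M : 'I_d -> 'M[R]_n) i j,
    kron M i j = \prod_k M k (coords i k) (coords j k).
Proof.
case: d => [|d].
  exists (fun _ (k : 'I_0) => False_rect _ (notF (ltn_ord k))) => M i j.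
  by rewrite big_ord0 /kron mxE (ord1 i) (ord1 j) eqxx.
rewrite /kron; elim: d => [|d [coords coordsP]].
  by exists (fun i _ => i) => M i j; rewrite big_ord1.
pose unindex (i : 'I_(n ^ d.+2)) := @mxtens_unindex n (n ^ d.+1) i.
exists (fun i k => if unlift ord0 k is Some k' then coords (unindex i).2 k'
                   else (unindex i).1) => M i j.
rewrite big_ord_recl unlift_none [LHS]mxE coordsP; congr (_ * _).
by apply: eq_bigr => k _; rewrite liftK.
Qed.

Lemma kron_bigsum n d L (M : 'I_d -> 'I_L -> 'M[R]_n) :
  kron (fun k => \sum_l M k l)
  = \sum_(j : d.-tuple 'I_L) kron (fun k => M k (tnth j k)).
Proof.
have [coords coordsP] := kron_entry n d.
apply/matrixP => a b; rewrite coordsP summxE.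
under eq_bigr do rewrite summxE.
rewrite bigA_distr_bigA.
pose ffun_of (j : d.-tuple 'I_L) := [ffun k => tnth j k].
rewrite (reindex ffun_of) /=; last first.
  exists (fun f : {ffun 'I_d -> 'I_L} => [tuple f k | k < d]) => f _.
    by apply: eq_from_tnth => k; rewrite tnth_mktuple ffunE.
  by apply/ffunP => k; rewrite ffunE tnth_mktuple.
by apply: eq_bigr => j _; rewrite coordsP; under eq_bigr do rewrite ffunE.
Qed.

Lemma kron_sumD n d (X Y : 'M[R]_n) :
  kron_sum d (X + Y) = kron_sum d X + kron_sum d Y.
Proof.
have [coords coordsP] := kron_entry n d.
rewrite /kron_sum -big_split; apply: eq_bigr => i _ /=.
apply/matrixP => a b; rewrite mxE !coordsP.
rewrite !(bigD1 (P := xpredT) i) //= !eqxx mxE mulrDl; congr (_ * _ + _ * _);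
  by apply: eq_bigr => k /negPf ->.
Qed.

Lemma tensmx11 m n : 1%:M *t 1%:M = 1%:M :> 'M[R]_(m * n).
Proof.
apply/matrixP => i j.
case: (mxtens_indexP i) => a b; case: (mxtens_indexP j) => a' b'.
rewrite tensmxE !mxE -natrM mulnb -xpair_eqE.
by rewrite (inj_eq (can_inj (@mxtens_indexK _ _))).
Qed.

Lemma kron1 n d : kron (fun _ : 'I_d => 1%:M) = 1%:M :> 'M[R]_(n ^ d).
Proof.
case: d => [//|d]; rewrite /kron; elim: d => [//|d /= ->]; exact: tensmx11.
Qed.

Lemma kron_sumS n d (X : 'M[R]_n) :
  kron_sum d.+2 X = X *t 1%:M + 1%:M *t kron_sum d.+1 X.
Proof.
rewrite /kron_sum big_ord_recl -(kron1 n d.+1); congr (_ + _).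
apply/matrixP => i j; rewrite !mxE !summxE mulr_sumr.
by apply: eq_bigr => k _; rewrite [LHS]mxE mxE.
Qed.

Definition mx_of_tens m n (u : 'cV[R]_(m * n)) : 'M[R]_(m, n) :=
  \matrix_(i, j) u (mxtens_index (i, j)) 0.

Lemma mx_of_tens_eq0 m n (u : 'cV[R]_(m * n)) : mx_of_tens u = 0 <-> u = 0.
Proof.
split=> [/matrixP u0|->]; last by apply/matrixP => i j; rewrite !mxE.
apply/colP => k; case: (mxtens_indexP k) => i j.
by have := u0 i j; rewrite !mxE.
Qed.

Lemma mx_of_tensM m n (X : 'M[R]_m) (Y : 'M[R]_n) u :
  mx_of_tens (X *t Y *m u) = X *m mx_of_tens u *m Y^T.
Proof.
apply/matrixP => i j; rewrite !mxE (reindex (@mxtens_index m n)) /=; last first.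
  exists (@mxtens_unindex m n) => k _; first exact: mxtens_indexK.
  exact: mxtens_unindexK.
under [RHS]eq_bigr do rewrite !mxE mulr_suml.
rewrite exchange_big pair_big /=; apply: eq_bigr => -[i' j'] _.
by rewrite tensmxE !mxE mulrAC.
Qed.

End Kronecker.

Section KroneckerOrder.
Variable R : rcfType.

Lemma psd_tens m n (X : 'M[R]_m) (Y : 'M[R]_n) :
  psd X -> psd Y -> psd (X *t Y).
Proof.
case=> p [F ->] [q [G ->]]; rewrite -tensmx_mul -trmx_tens.
exact: psd_gram.
Qed.

Lemma loewner_tens m n (X X' : 'M[R]_m) (Y Y' : 'M[R]_n) :
  psd X -> X <=L X' -> psd Y -> Y <=L Y' -> X *t Y <=L X' *t Y'.
Proof.
move=> psdX leX psdY leY.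
have -> : X' *t Y' = X *t Y + ((X' - X) *t Y' + X *t (Y' - Y)).
  by apply/matrixP => i j; rewrite !mxE; ring.
apply/loewner_addr/psdD; apply: psd_tens => //; exact: loewner_ge0 leY.
Qed.

Lemma psd_kron n d (M : 'I_d -> 'M[R]_n) :
  (forall k, psd (M k)) -> psd (kron M).
Proof.
case: d M => [|d] M psdM; first exact: psd1.
rewrite /kron; elim: d M psdM => [|d IH] M psdM; first exact: psdM.
by apply: psd_tens; [exact: psdM | apply: IH => k; exact: psdM].
Qed.

Lemma loewner_kron n d (M M' : 'I_d -> 'M[R]_n) :
  (forall k, psd (M k)) -> (forall k, M k <=L M' k) -> kron M <=L kron M'.
Proof.
case: d M M' => [|d] M M' psdM leM; first exact: loewner_refl.
elim: d M M' psdM leM => [|d IH] M M' psdM leM; first exact: leM.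
apply: loewner_tens; [exact: psdM | exact: leM | | ].
  by apply: (@psd_kron _ d.+1) => k; exact: psdM.
by apply: IH => k; [exact: psdM | exact: leM].
Qed.

Lemma psd_kron_sum n d (X : 'M[R]_n) : psd X -> psd (kron_sum d X).
Proof.
move=> psdX; apply: psd_sum => i _; apply: psd_kron => k.
by case: ifP => _ //; exact: psd1.
Qed.

Lemma constant_mx_of_tens m n (u : 'cV[R]_(m * n)) : constant_cV u <->
  (forall i i' j, mx_of_tens u i j = mx_of_tens u i' j) /\
  (forall j j' i, mx_of_tens u i j = mx_of_tens u i j').
Proof.
split=> [u_const|[col_const row_const] k k'].
  by split=> *; rewrite !mxE; exact: u_const.
case: (mxtens_indexP k) => i j; case: (mxtens_indexP k') => i' j'.
by have := col_const i i' j; have := row_const j j' i'; rewrite !mxE => <-.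
Qed.

Lemma ker_constant_tens m n (X : 'M[R]_m) (Y : 'M[R]_n) : psd X -> psd Y ->
  ker_constant X -> ker_constant Y -> ker_constant (X *t 1%:M + 1%:M *t Y).
Proof.
move=> psdX psdY kerX kerY u; rewrite constant_mx_of_tens.
rewrite psdD_mulmx_eq0; [|by apply: psd_tens => //; exact: psd1..].
rewrite -!mx_of_tens_eq0 !mx_of_tensM trmx1 mulmx1 mul1mx.
rewrite (ker_constant_mx _ kerX); apply: and_iff_compat_l.
rewrite -[in X in X <-> _](trmxK (mx_of_tens u)) -trmx_mul.
have trmx_eq0_iff : (Y *m (mx_of_tens u)^T)^T = 0 <-> Y *m (mx_of_tens u)^T = 0.
  by split=> [/eqP|->]; [rewrite trmx_eq0 => /eqP | rewrite trmx0].
rewrite trmx_eq0_iff (ker_constant_mx _ kerY).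
by split=> U_const j j' i; have := U_const j j' i; rewrite !mxE.
Qed.

Lemma ker_constant_kron_sum n d (X : 'M[R]_n) : (0 < d)%N ->
  psd X -> ker_constant X -> ker_constant (kron_sum d X).
Proof.
case: d => // d _ psdX kerX; elim: d => [|d IH].
  by rewrite /kron_sum big_ord1.
rewrite kron_sumS; apply: ker_constant_tens => //.
exact: (psd_kron_sum d.+1 psdX).
Qed.

End KroneckerOrder.

(** * Matrices assembled from intervals of a grid *)

Section Windows.
Variable R : realType.

Definition window n w s (i : 'I_w.+1) : 'I_n.+1 := inord (s + i).

Definition window_mx n w s : 'M[R]_(w.+1, n.+1) := rowsub (@window n w s) 1%:M.

Lemma val_window n w s (i : 'I_w.+1) :
  (s + w <= n)%N -> window n s i = (s + i)%N :> nat.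
Proof. by move=> swn; rewrite inordK //; have := leq_ord i; lia. Qed.

Lemma window_comp n w v s e (i : 'I_v.+1) : (s + w <= n)%N -> (e + v <= w)%N ->
  window n s (window w e i) = window n (s + e) i.
Proof.
move=> swn evw; apply: val_inj => /=; rewrite !val_window ?addnA //.
by rewrite -addnA (leq_trans _ swn) // leq_add2l.
Qed.

Lemma window_mxM n w v s e : (s + w <= n)%N -> (e + v <= w)%N ->
  window_mx w v e *m window_mx n w s = window_mx n v (s + e).
Proof.
move=> swn evw; rewrite -rowsubE -rowsub_comp.
by apply: eq_rowsub => i; exact: window_comp.
Qed.

Lemma window_mx_id n : window_mx n n 0 = 1%:M.
Proof. by apply/matrixP => i j; rewrite !mxE /window add0n inord_val. Qed.

Lemma window_mx_cV n w s (u : 'cV[R]_n.+1) i :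
  (window_mx n w s *m u) i 0 = u (window n s i) 0.
Proof. by rewrite -rowsubE mxE. Qed.

Lemma window_mx_tr_id n w s : (s + w <= n)%N ->
  window_mx n w s *m (window_mx n w s)^T = 1%:M.
Proof.
move=> swn; rewrite -rowsubE; apply/matrixP => i j; rewrite !mxE.
by rewrite [i == j]eq_sym -val_eqE /= !val_window // eqn_add2l.
Qed.

Lemma sum_window n w s (F : 'I_w.+1 -> R) (i : 'I_n.+1) : (s + w <= n)%N ->
  \sum_a (window n s a == i)%:R * F a
  = if (s <= i <= s + w)%N then F (inord (i - s)) else 0.
Proof.
move=> swn; have windowE (a : 'I_w.+1) : (window n s a == i) = (s + a == i)%N.
  by rewrite -val_eqE /= val_window.
under eq_bigr do rewrite windowE; case: ifPn => [/andP[si isw]|si].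
  rewrite (bigD1 (inord (i - s))) //= inordK ?subnKC ?eqxx ?mul1r; try lia.
  rewrite big1 ?addr0 // => a; rewrite -val_eqE /= inordK; last by lia.
  by move=> /eqP ai; case: eqP => [|_]; [lia | rewrite mul0r].
rewrite big1 // => a _; case: eqP => [sai|_]; last by rewrite mul0r.
by have := leq_ord a; lia.
Qed.

Lemma embed_blockE n w s (X : 'M[R]_w.+1) : (s + w <= n)%N ->
  embed_block n.+1 s X = (window_mx n w s)^T *m X *m window_mx n w s.
Proof.
move=> swn; apply/matrixP => i j; rewrite -mulmxA !mxE.
under [RHS]eq_bigr do rewrite !mxE.
rewrite sum_window //; case: (s <= i <= s + w)%N => //=.
under eq_bigr do rewrite !mxE mulrC.
by rewrite sum_window.
Qed.

Lemma embed_block_id n (X : 'M[R]_n.+1) : embed_block n.+1 0 X = X.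
Proof. by rewrite embed_blockE // window_mx_id trmx1 mul1mx mulmx1. Qed.

Lemma embed_block_comp n w v s e (X : 'M[R]_v.+1) :
  (s + w <= n)%N -> (e + v <= w)%N ->
  embed_block n.+1 s (embed_block w.+1 e X) = embed_block n.+1 (s + e) X.
Proof.
move=> swn evw; rewrite !embed_blockE //; last by lia.
by rewrite -(window_mxM swn evw) trmx_mul !mulmxA.
Qed.

Lemma embed_block_sum n w s (I : Type) (r : seq I) (X : I -> 'M[R]_w.+1) :
  (s + w <= n)%N ->
  embed_block n.+1 s (\sum_(i <- r) X i)
  = \sum_(i <- r) embed_block n.+1 s (X i).
Proof.
move=> swn; rewrite embed_blockE // mulmx_sumr mulmx_suml.
by apply: eq_bigr => i _; rewrite embed_blockE.
Qed.

Lemma loewner_embed_block n w s (X Y : 'M[R]_w.+1) : (s + w <= n)%N ->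
  X <=L Y -> embed_block n.+1 s X <=L embed_block n.+1 s Y.
Proof. by move=> swn XY; rewrite !embed_blockE //; exact: loewner_congr. Qed.

Lemma psd_embed_block n w s (X : 'M[R]_w.+1) : (s + w <= n)%N ->
  psd X -> psd (embed_block n.+1 s X).
Proof. by move=> swn psdX; rewrite embed_blockE //; exact: psd_congr. Qed.

Lemma embed_block_mulmx_eq0 n w s (X : 'M[R]_w.+1) (u : 'cV_n.+1) :
  (s + w <= n)%N ->
  embed_block n.+1 s X *m u = 0 <-> X *m (window_mx n w s *m u) = 0.
Proof.
move=> swn; rewrite embed_blockE // -!mulmxA.
split=> [Xu0|->]; last exact: mulmx0.
by rewrite -[LHS]mul1mx -(window_mx_tr_id swn) -mulmxA Xu0 mulmx0.
Qed.

End Windows.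

Section Assembled.
Variables (R : realType) (X : forall w, 'M[R]_w.+1).

(* [X w] stands for the matrix of a segment of [w] grid intervals, hence of
   [w.+1] nodes; adjacent segments share one node. *)
Definition assembled : Prop := forall v w, (0 < v)%N -> (0 < w)%N ->
  X (v + w) = embed_block (v + w).+1 0 (X v) + embed_block (v + w).+1 v (X w).

Hypothesis X_assembled : assembled.

Lemma assembled_tile n L : (0 < n)%N -> (0 < L)%N ->
  X (n * L) = \sum_(j < L) embed_block (n * L).+1 (j * n) (X n).
Proof.
move=> n_gt0; elim: L => // -[_ _|L IH _].
  by rewrite big_ord1 mul0n muln1 embed_block_id.
rewrite mulnSr X_assembled ?muln_gt0 ?n_gt0 // IH // [RHS]big_ord_recr /=.
rewrite embed_block_sum; last by lia.
rewrite mulnC; congr (_ + _); apply: eq_bigr => j _.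
by rewrite embed_block_comp //; have := ltn_ord j; nia.
Qed.

Lemma psd_assembled : psd (X 1) -> forall n, (0 < n)%N -> psd (X n).
Proof.
move=> psdX1 [//|n _]; elim: n => [//|n IH].
rewrite -[n.+2]addn1 X_assembled //.
by apply: psdD; apply: psd_embed_block => //; lia.
Qed.

Lemma ker_constant_assembledD v w : (0 < v)%N -> (0 < w)%N ->
  psd (X v) -> psd (X w) -> ker_constant (X v) -> ker_constant (X w) ->
  ker_constant (X (v + w)).
Proof.
move=> v_gt0 w_gt0 psdXv psdXw kerXv kerXw u; rewrite X_assembled //.
rewrite psdD_mulmx_eq0; [|by apply: psd_embed_block => //; lia..].
rewrite !embed_block_mulmx_eq0 ?leq_addr // kerXv kerXw.
split=> [[u_left u_right] | u_const]; last first.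
  by split=> i j; rewrite !window_mx_cV; exact: u_const.
suff to_joint i : u i 0 = u (inord v) 0 by move=> i j; rewrite !to_joint.
have [iv|vi] := leqP i v.
  have := u_left (inord i) ord_max; rewrite !window_mx_cV /window /= !add0n.
  by rewrite inordK // inord_val.
have := u_right (inord (i - v)) ord0; rewrite !window_mx_cV /window /= addn0.
by rewrite inordK ?subnKC ?inord_val //; have := leq_ord i; lia.
Qed.

Lemma ker_constant_assembled : psd (X 1) -> ker_constant (X 1) ->
  forall n, (0 < n)%N -> ker_constant (X n).
Proof.
move=> psdX1 kerX1 [//|n _]; elim: n => [//|n IH].
rewrite -[n.+2]addn1; apply: ker_constant_assembledD => //.
exact: psd_assembled.
Qed.

Hypothesis psdX : forall w, (0 < w)%N -> psd (X w).

Lemma loewner_assembled_prefix v w : (0 < v)%N ->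
  embed_block (v + w).+1 0 (X v) <=L X (v + w).
Proof.
case: w => [|w] v_gt0.
  by rewrite addn0 embed_block_id; exact: loewner_refl.
rewrite X_assembled //; apply/loewner_addr/psd_embed_block => //.
exact: psdX.
Qed.

Lemma loewner_assembled_suffix v w : (0 < w)%N ->
  embed_block (v + w).+1 v (X w) <=L X (v + w).
Proof.
case: v => [|v] w_gt0; first by rewrite embed_block_id; exact: loewner_refl.
rewrite X_assembled // addrC.
by apply/loewner_addr/psd_embed_block; [rewrite leq_addr | exact: psdX].
Qed.

Lemma loewner_assembled_window n w s : (0 < w)%N -> (s + w <= n)%N ->
  embed_block n.+1 s (X w) <=L X n.
Proof.
move=> w_gt0 /subnKC <-; set t := (n - (s + w))%N.
apply: loewner_trans (@loewner_assembled_prefix (s + w) t _); last by lia.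
have -> : embed_block (s + w + t).+1 s (X w)
          = embed_block (s + w + t).+1 0 (embed_block (s + w).+1 s (X w)).
  by rewrite embed_block_comp //; lia.
by apply: loewner_embed_block; [lia | exact: loewner_assembled_suffix].
Qed.

Lemma loewner_assembled_windows n L w (start : 'I_L -> nat) :
  (0 < w)%N -> (0 < L)%N ->
  (forall j : 'I_L, j * n <= start j /\ start j + w <= j * n + n)%N ->
  \sum_(j < L) embed_block (n * L).+1 (start j) (X w) <=L X (n * L).
Proof.
move=> w_gt0 L_gt0 inside.
have n_gt0 : (0 < n)%N by have := inside (Ordinal L_gt0); lia.
rewrite assembled_tile //; apply: loewner_sum => j _.
have [start_ge start_le] := inside j.
have tile_le : (j * n + n <= n * L)%N by have := ltn_ord j; nia.
pose offset := (start j - j * n)%N.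
have -> : embed_block (n * L).+1 (start j) (X w)
          = embed_block (n * L).+1 (j * n) (embed_block n.+1 offset (X w)).
  by rewrite embed_block_comp ?subnKC //; lia.
by apply: loewner_embed_block => //; apply: loewner_assembled_window => //; lia.
Qed.

End Assembled.

Section GridMatrices.
Variable R : realType.

(* For entries given by case distinctions on [i] and [j]: exhausts all the
   comparisons of indices. *)
Ltac entry_cases i j :=
  rewrite -?val_eqE /=; have := leq_ord i; have := leq_ord j;
  move: (i : nat) (j : nat) => a b b_le a_le;
  rewrite ?[_ *+ (_ == _)]mulrb;
  repeat (first [ rewrite inordK; last (by lia)
                | case: leqP => ? | case: eqP => ? ];
          rewrite /=; try (exfalso; lia));
  first [ring | field].

Lemma lap_neumann_assembled : assembled (lap_neumann R).
Proof.
by move=> v w v_gt0 w_gt0; apply/matrixP => i j; rewrite !mxE; entry_cases i j.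
Qed.

Lemma half_id_assembled : assembled (half_id R).
Proof.
by move=> v w v_gt0 w_gt0; apply/matrixP => i j; rewrite !mxE; entry_cases i j.
Qed.

Lemma psd_half_id n : psd (half_id R n).
Proof.
by apply: psd_diag => i; rewrite mxE; case: ifP; rewrite ?invr_ge0 ?ler0n.
Qed.

Lemma half_id_le1 n : half_id R n <=L 1%:M.
Proof.
rewrite /loewner -diag_const_mx /half_id.
rewrite -linearB; apply: psd_diag => i; rewrite !mxE.
by case: ifP => _; lra.
Qed.

Definition corner_row n : 'rV[R]_n.+1 := delta_mx 0 ord0 - delta_mx 0 ord_max.

Lemma corner_gram n :
  (0 < n)%N -> corner R n = (corner_row n)^T *m corner_row n.
Proof.
move=> n_gt0; apply/matrixP => i j.
by rewrite mxE [RHS]mxE big_ord1 !mxE; entry_cases i j.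
Qed.

Lemma psd_corner n : (0 < n)%N -> psd (corner R n).
Proof. by move=> n_gt0; rewrite corner_gram //; exact: psd_gram. Qed.

Lemma corner_mulmx_eq0 n (u : 'cV[R]_n.+1) : (0 < n)%N ->
  corner R n *m u = 0 <-> u ord0 0 = u ord_max 0.
Proof.
move=> n_gt0; rewrite corner_gram // gram_mulmx_eq0 mulmxBl -!rowE.
split=> [/rowP/(_ 0)|u_eq].
  by rewrite !mxE => /eqP; rewrite subr_eq0 => /eqP.
by apply/rowP => i; rewrite !ord1 !mxE u_eq subrr.
Qed.

Lemma lap_neumann1 : lap_neumann R 1 = corner R 1.
Proof. by apply/matrixP => i j; rewrite !mxE; entry_cases i j. Qed.

Lemma psd_lap_neumann n : (0 < n)%N -> psd (lap_neumann R n).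
Proof.
apply: (psd_assembled lap_neumann_assembled).
by rewrite lap_neumann1; exact: psd_corner.
Qed.

Lemma ker_constant_lap_neumann n : (0 < n)%N -> ker_constant (lap_neumann R n).
Proof.
apply: (ker_constant_assembled lap_neumann_assembled).
  exact: psd_lap_neumann.
move=> u; rewrite lap_neumann1 corner_mulmx_eq0 //.
split=> [u01 i j|]; last exact.
suff to0 k : u k 0 = u ord0 0 by rewrite !to0.
case: (unliftP ord0 k) => [k' ->|-> //].
by rewrite ord1 u01; congr (u _ 0); exact: val_inj.
Qed.

Lemma val_ord_sub n (i j : 'I_n.+1) :
  (i - j)%R = (if j <= i then i - j else i + n.+1 - j)%N :> nat.
Proof.
have [i_lt j_lt] := (ltn_ord i, ltn_ord j); rewrite /= modnDmr.
case: leqP => ij; last by rewrite modn_small; lia.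
by rewrite addnBA ?(ltnW j_lt) // addnC -addnBA // modnDl modn_small; lia.
Qed.

Lemma lap_perE n : (1 < n)%N -> lap_per R n = lap_neumann R n + corner R n.
Proof.
move=> n_gt1; apply/matrixP => i j.
by rewrite [LHS]mxE [LHS]mxE val_ord_sub !mxE; entry_cases i j.
Qed.

Lemma psd_lap_per n : (1 < n)%N -> psd (lap_per R n).
Proof.
move=> n_gt1; have n_gt0 := ltnW n_gt1; rewrite lap_perE //.
by apply: psdD; [exact: psd_lap_neumann | exact: psd_corner].
Qed.

Lemma ker_constant_lap_per n : (1 < n)%N -> ker_constant (lap_per R n).
Proof.
move=> n_gt1 u; have n_gt0 := ltnW n_gt1; rewrite lap_perE //.
have [psdN psdC] := (psd_lap_neumann n_gt0, psd_corner n_gt0).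
rewrite (psdD_mulmx_eq0 _ psdN psdC) ker_constant_lap_neumann //.
rewrite corner_mulmx_eq0 //.
by split=> [[]|u_const].
Qed.

End GridMatrices.

(** * The checkerboard coefficient *)

Section Checkerboard.
Variables (R : realType) (n0 L w d : nat) (K : {set d.-tuple 'I_L}).
Hypotheses (w_gt0 : (0 < w)%N) (w_le : (w <= n0)%N) (n_gt1 : (1 < n0 * L)%N).

Local Notation n := (n0 * L)%N.

Lemma cell_start_inside (j : 'I_L) :
  (j * n0 <= cell_start n0 w j /\ cell_start n0 w j + w <= j * n0 + n0)%N.
Proof. by rewrite /cell_start; lia. Qed.

Lemma cell_start_le (j : 'I_L) : (cell_start n0 w j + w <= n)%N.
Proof. by have := cell_start_inside j; have := ltn_ord j; nia. Qed.

Lemma psd_Qbar (j : 'I_L) : psd (Qbar R n0 w j).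
Proof.
by apply: psd_embed_block; [exact: cell_start_le | exact: psd_lap_neumann].
Qed.

Lemma psd_Ibar (j : 'I_L) : psd (Ibar R n0 w j).
Proof.
by apply: psd_embed_block; [exact: cell_start_le | exact: psd_half_id].
Qed.

Let L_gt0 : (0 < L)%N.
Proof. by case: (L) n_gt1 => //; rewrite muln0. Qed.

Lemma sum_Qbar_le : \sum_(j < L) Qbar R n0 w j <=L lap_neumann R n.
Proof.
apply: (loewner_assembled_windows (@lap_neumann_assembled R)) => //.
- exact: psd_lap_neumann.
- exact: cell_start_inside.
Qed.

Lemma sum_Ibar_le : \sum_(j < L) Ibar R n0 w j <=L 1%:M.
Proof.
apply: loewner_trans (half_id_le1 R n).
apply: (loewner_assembled_windows (@half_id_assembled R)) => //.
- by move=> ? _; exact: psd_half_id.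
- exact: cell_start_inside.
Qed.

Definition cell_factor (i k : 'I_d) (j : 'I_L) : 'M[R]_n.+1 :=
  if k == i then Qbar R n0 w j else Ibar R n0 w j.

Definition cell_stiff (j : d.-tuple 'I_L) : 'M[R]_(n.+1 ^ d) :=
  \sum_(i < d) kron (fun k => cell_factor i k (tnth j k)).

Lemma psd_cell_factor i k j : psd (cell_factor i k j).
Proof.
by rewrite /cell_factor; case: ifP => _; [exact: psd_Qbar | exact: psd_Ibar].
Qed.

Lemma psd_cell_stiff j : psd (cell_stiff j).
Proof.
by apply: psd_sum => i _; apply: psd_kron => k; exact: psd_cell_factor.
Qed.

Lemma sum_cell_stiff_le : \sum_j cell_stiff j <=L kron_sum d (lap_neumann R n).
Proof.
rewrite exchange_big; apply: loewner_sum => i _ /=; rewrite -kron_bigsum.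
apply: loewner_kron => k.
  by apply: psd_sum => j _; exact: psd_cell_factor.
rewrite /cell_factor; case: ifP => _; [exact: sum_Qbar_le | exact: sum_Ibar_le].
Qed.

Lemma psd_A_stoch : psd (A_stoch R n0 w K).
Proof.
apply: psdD; last by apply/psd_kron_sum/psd_corner/ltnW.
by apply: psd_sum => j _; exact: psd_cell_stiff.
Qed.

Lemma A_stoch_le : A_stoch R n0 w K <=L A_lap R d n0 L.
Proof.
rewrite /A_lap lap_perE // kron_sumD; apply: loewnerD; last exact: loewner_refl.
apply: loewner_trans sum_cell_stiff_le.
by apply: loewner_sum_cond => j; exact: psd_cell_stiff.
Qed.

Variable lambda : R.
Hypotheses (lambda_gt0 : 0 < lambda) (lambda_le1 : lambda <= 1).

Lemma A_stiff_ge : lambda *: A_lap R d n0 L <=L A_stiff n0 w lambda K.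
Proof. by apply/loewner_addr/psdZ/psd_A_stoch; rewrite subr_ge0. Qed.

Lemma A_stiff_le : A_stiff n0 w lambda K <=L A_lap R d n0 L.
Proof.
rewrite -[X in _ <=L X]scale1r -(subrKC lambda 1) scalerDl.
apply: loewnerD; first exact: loewner_refl.
by rewrite /loewner -scalerBr; apply: psdZ A_stoch_le; rewrite subr_ge0.
Qed.

Let mean_gt0 : 0 < (1 + lambda) / 2.
Proof. by rewrite divr_gt0 ?addr_gt0. Qed.

Lemma psd_B_lap : psd (B_lap d n0 L lambda).
Proof. by apply/psdZ/psd_kron_sum/psd_lap_per => //; exact: ltW. Qed.

Lemma ker_constant_B_lap : (0 < d)%N -> ker_constant (B_lap d n0 L lambda).
Proof.
move=> d_gt0; apply: ker_constantZ; first by rewrite gt_eqF.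
by apply/ker_constant_kron_sum/ker_constant_lap_per => //; exact: psd_lap_per.
Qed.

Lemma precond_A_stiff_cond : (0 < d)%N ->
  exists2 c, is_cond_on (@ones_orth R (n.+1 ^ d))
               (mp_pinv (B_lap d n0 L lambda) *m A_stiff n0 w lambda K) c
           & c <= lambda^-1.
Proof.
move=> d_gt0; set t := (1 + lambda) / 2.
have scaleB a : (a / t) *: B_lap d n0 L lambda = a *: A_lap R d n0 L.
  by rewrite scalerA divfK // gt_eqF.
have dim_gt1 : (1 < n.+1 ^ d)%N.
  by rewrite -[1%N](expn0 n.+1) ltn_exp2l // (ltn_trans n_gt1).
have -> : lambda^-1 = (1 / t) / (lambda / t).
  by rewrite mul1r (invf_div lambda) mulKf // gt_eqF.
apply: precond_ones_orth_cond dim_gt1 psd_B_lap _ _ _ _.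
- exact: ker_constant_B_lap.
- exact: divr_gt0.
- by rewrite scaleB; exact: A_stiff_ge.
- by rewrite scaleB scale1r; exact: A_stiff_le.
Qed.

End Checkerboard.

Theorem lemma4p1 (R : realType) (d : nat) (hd : d = 2%N \/ d = 3%N) :
  exists2 C : R, 0 < C &
    forall (p0 n0 L w : nat) (alpha lambda : R) (K : {set d.-tuple 'I_L}),
      (2 <= p0)%N -> n0 = (2 ^ p0)%N -> (1 <= L)%N ->
      2 * alpha * n0%:R = w%:R -> ~~ odd w -> (2 <= w <= n0)%N ->
      0 < lambda -> lambda <= 1 ->
      exists2 c : R,
        is_cond_on (@ones_orth R ((n0 * L).+1 ^ d))
          (mp_pinv (B_lap d n0 L lambda) *m A_stiff n0 w lambda K) c
        & c <= C * lambda^-1.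
Proof.
exists 1 => // p0 n0 L w _ lambda K _ _ L_gt0 _ _ /andP[w_ge2 w_le] l_gt0 l_le1.
have d_gt0 : (0 < d)%N by case: hd => ->.
have n_gt1 : (1 < n0 * L)%N.
  exact: leq_trans (leq_trans w_ge2 w_le) (leq_pmulr _ L_gt0).
rewrite mul1r; exact: precond_A_stiff_cond (ltnW w_ge2) w_le n_gt1 _ _ _ _.
Qed.
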